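(* Let $T$ be a coherent theory over a signature $\Sigma$ without equality, and let $T^+$ be the theory in logic with equality consisting of $T$, the equality axioms (equality is a congruence), and the constructor axioms: (I) $f(\vec x)=g(\vec y)\to\bot$ for distinct function symbols $f,g$; (II) $f(\vec x)=f(\vec y)\to\vec x=\vec y$ for each function symbol $f$; (III) $x=f(\vec s)\to\bot$ whenever the variable $x$ occurs in the sequence of terms $\vec s$. Then for every geometric sentence $\phi$ in logic with equality over $\Sigma$, and for each of the three forcing relations (on $\mathbb{C}_{\mathrm{rn}}$, $\mathbb{C}_{\mathrm{vs}}$, $\mathbb{C}_{\mathrm{ts}}$, with coverage $\lhd_T$), if $(;)\Vdash\phi$ then $T^+\vdash_\emptyset\phi$.
   Context: Conditions $(X;A)$: $X$ finite set of variables, $A$ finite set of atoms (without equality) over $X$; $(;)$ is the empty condition. $\mathrm{Tm}(X)$: terms over $X$. $\mathbb{C}_{\mathrm{ts}}$: morphisms $f:(Y;B)\to(X;A)$ are maps $f:X\to\mathrm{Tm}(Y)$ with $Af\subseteq B$ (postfix substitution); $\mathbb{C}_{\mathrm{vs}}$: variable-to-variable maps; $\mathbb{C}_{\mathrm{rn}}$: injective variable maps. Coherent theory: axioms $\forall\vec x.(\phi_0\to\exists\vec x_1.\phi_1\lor\dots\lor\exists\vec x_k.\phi_k)$, $\phi_i$ finite conjunctions of atoms. $C\lhd_T U$ (also $U\rhd C$) inductively: isomorphism singletons cover; if an instance (terms of $\mathrm{Tm}(X)$ for universal variables) $\phi_0\to\exists\vec x_1.\phi_1\lor\dots\lor\exists\vec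 x_n.\phi_n$ of an axiom has atoms of $\phi_0$ in $A$, $\vec x_i$ fresh, and $(X,\vec x_i;A,\phi_i)\lhd_T U_i$, then $(X;A)\lhd_T\bigcup_ie_iU_i$ with $e_i:(X,\vec x_i;A,\phi_i)\to(X;A)$ the identity on $X$. Forcing: $\top$ always; $\bot$ iff $C\lhd_T\emptyset$; atom $\psi$ iff some $U\rhd C$ with $\psi f$ an atom of the domain for all $f\in U$; $s=t$ iff some $U\rhd C$ with $sf=tf$ (syntactically) for all $f\in U$; $\bigwedge$ componentwise; $\bigvee_i\psi_i$ iff some $U\rhd C$ with each $f:D\to C$ in $U$ having $D\Vdash\psi_if$ for some $i$; $\psi_1\to\psi_2$ iff for all $f:D\to C$, $D\Vdash\psi_1f$ implies $D\Vdash\psi_2f$; $\forall x.\psi$ iff $D\Vdash\psi[f,x:=t]$ for all $f:D\to C$ and $t\in\mathrm{Tm}(D)$; $\exists x.\psi$ iff some $U\rhd C$ with each $f:D\to C$ in $U$ having $D\Vdash\psi[f,x:=t]$ for some $t\in\mathrm{Tm}(D)$. A geometric sentence is a (conjunction of) sentences $\forall\vec x.(\phi_0\to\bigvee_{i\in I}\exists\vec x_i.\phi_i)$ with $\phi_i$ finite conjunctions of atoms (here possibly equations) and $I$ small. $\vdash_\emptyset$: intuitionistic (possibly infinitary) derivability with equality, with quantifier rules valid for possibly empty domains. *)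

(* Defs.v *)
From Stdlib Require List.
From mathcomp Require Import all_boot finmap.
From mathcomp Require Import boolp classical_sets functions cardinality.

Set Implicit Arguments.
Unset Strict Implicit.
Unset Printing Implicit Defensive.

Local Open Scope fset_scope.
Local Open Scope classical_set_scope.

Record signature := Signature {
  funsym : Type;
  fun_arity : funsym -> nat;
  relsym : Type;
  rel_arity : relsym -> nat }.

Definition no_var (A : Type) : 'I_0 -> A :=
  fun i => False_rect A (notF (ltn_ord i)).

(* [scons t r] is the assignment (r, x := t): a binder is de Bruijn index 0. *)
Definition scons (A : Type) n (t : A) (r : 'I_n -> A) : 'I_n.+1 -> A :=
  fun i => oapp r t (unlift ord0 i).

(* On 'I_(k + n), the first k indices are the innermost block of variables. *)
Definition sapp (A : Type) k n (r' : 'I_k -> A) (r : 'I_n -> A) :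
    'I_(k + n) -> A :=
  fun i => match fintype.split i with inl j => r' j | inr j => r j end.

Section Syntax.
Variable S : signature.

Inductive term (V : Type) : Type :=
| Var of V
| App (f : funsym S) of ('I_(fun_arity f) -> term V).

Inductive atom (V : Type) : Type :=
| Atom (p : relsym S) of ('I_(rel_arity p) -> term V).

Fixpoint tsubst V W (s : V -> term W) (t : term V) : term W :=
  match t with
  | Var x => s x
  | App f a => App (fun i => tsubst s (a i))
  end.

Definition asubst V W (s : V -> term W) (a : atom V) : atom W :=
  let: Atom p ts := a in Atom (fun i => tsubst s (ts i)).

Fixpoint occurs V (x : V) (t : term V) : Prop :=
  match t with
  | Var y => x = y
  | App f a => exists i, occurs x (a i)
  end.

Lemma tsubst_comp V W Z (s : V -> term W) (r : W -> term Z) t :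
  tsubst r (tsubst s t) = tsubst (fun x => tsubst r (s x)) t.
Proof. by elim: t => //= f a IH; congr App; apply/funext. Qed.

Lemma asubst_comp V W Z (s : V -> term W) (r : W -> term Z) a :
  asubst r (asubst s a) = asubst (fun x => tsubst r (s x)) a.
Proof.
by case: a => p ts /=; congr Atom; apply/funext => i; rewrite tsubst_comp.
Qed.

Lemma tsubst_Var V (t : term V) : tsubst (@Var V) t = t.
Proof. by elim: t => //= f a IH; congr App; apply/funext. Qed.

Lemma asubst_Var V (a : atom V) : asubst (@Var V) a = a.
Proof.
by case: a => p ts /=; congr Atom; apply/funext => i; rewrite tsubst_Var.
Qed.

(* Infinitary first-order formulas with equality whose free variables are
   indexed by 'I_n. *)
Inductive formula : nat -> Type :=
| FTop n : formula n
| FBot n : formula n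
| FAtom n of atom 'I_n : formula n
| FEq n of term 'I_n & term 'I_n : formula n
| FAnd n (I : Type) of (I -> formula n) : formula n
| FOr n (I : Type) of (I -> formula n) : formula n
| FImp n of formula n & formula n : formula n
| FAll n of formula n.+1 : formula n
| FEx n of formula n.+1 : formula n.

Definition shift n (t : term 'I_n) : term 'I_n.+1 :=
  tsubst (fun i => Var (lift ord0 i)) t.

Definition up n m (s : 'I_n -> term 'I_m) : 'I_n.+1 -> term 'I_m.+1 :=
  scons (Var ord0) (fun i => shift (s i)).

Fixpoint fsubst n (p : formula n) : forall m, ('I_n -> term 'I_m) -> formula m :=
  match p in formula n return forall m, ('I_n -> term 'I_m) -> formula m with
  | FTop _ => fun m s => FTop m
  | FBot _ => fun m s => FBot m
  | FAtom _ a => fun m s => FAtom (asubst s a)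
  | FEq _ t u => fun m s => FEq (tsubst s t) (tsubst s u)
  | FAnd _ J q => fun m s => FAnd (fun i => fsubst (q i) s)
  | FOr _ J q => fun m s => FOr (fun i => fsubst (q i) s)
  | FImp _ q r => fun m s => FImp (fsubst q s) (fsubst r s)
  | FAll _ q => fun m s => FAll (fsubst q (up s))
  | FEx _ q => fun m s => FEx (fsubst q (up s))
  end.

Definition fshift n (p : formula n) : formula n.+1 :=
  fsubst p (fun i => Var (lift ord0 i)).

Definition finst n (p : formula n.+1) (t : term 'I_n) : formula n :=
  fsubst p (scons t (@Var _)).

Fixpoint all_block n : formula n -> formula 0 :=
  match n return formula n -> formula 0 with
  | 0 => id
  | n'.+1 => fun p => all_block (FAll p)
  end.

Fixpoint ex_block k n : formula (k + n) -> formula n :=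
  match k return formula (k + n) -> formula n with
  | 0 => id
  | k'.+1 => fun p => @ex_block k' n (FEx p)
  end.

Definition fin_conj n (s : seq (formula n)) : formula n :=
  FAnd (fun i : 'I_(size s) => nth (FTop n) s i).

(* forall x_1 .. x_n, (prem -> \/_(i < m) exists y_1 .. y_(k i), concl i) *)
Record coherent_axiom := CoherentAxiom {
  ca_n : nat;
  ca_prem : seq (atom 'I_ca_n);
  ca_m : nat;
  ca_k : 'I_ca_m -> nat;
  ca_concl : forall i : 'I_ca_m, seq (atom 'I_(ca_k i + ca_n)) }.

Definition coherent_formula (a : coherent_axiom) : formula 0 :=
  all_block (FImp (fin_conj (map (@FAtom _) (ca_prem a)))
    (FOr (fun i => ex_block (fin_conj (map (@FAtom _) (@ca_concl a i)))))).

Inductive eatom (n : nat) : Type :=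
| EAtom of atom 'I_n
| EEq of term 'I_n & term 'I_n.

Definition eatom_formula n (e : eatom n) : formula n :=
  match e with EAtom a => FAtom a | EEq t u => FEq t u end.

Record geometric_sequent := GeometricSequent {
  gs_n : nat;
  gs_prem : seq (eatom gs_n);
  gs_I : Type;
  gs_k : gs_I -> nat;
  gs_concl : forall i : gs_I, seq (eatom (gs_k i + gs_n)) }.

Definition geometric_formula (g : geometric_sequent) : formula 0 :=
  all_block (FImp (fin_conj (map (@eatom_formula _) (gs_prem g)))
    (FOr (fun i =>
       ex_block (fin_conj (map (@eatom_formula _) (@gs_concl g i)))))).

Inductive geometric : formula 0 -> Prop :=
| geometric_one (g : geometric_sequent) : geometric (geometric_formula g)
| geometric_conj (J : Type) (g : J -> geometric_sequent) :
    geometric (FAnd (fun j => geometric_formula (g j))).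

(* Natural deduction for infinitary intuitionistic logic with equality. The
   free variables of a judgement are those of 'I_n, and only terms over 'I_n
   instantiate quantifiers, so that the domain may be empty. *)
Inductive derivable (Th : formula 0 -> Prop) :
    forall n, seq (formula n) -> formula n -> Prop :=
| d_ax n (G : seq (formula n)) p :
    Th p -> derivable Th G (fsubst p (@no_var _))
| d_hyp n (G : seq (formula n)) p : List.In p G -> derivable Th G p
| d_topI n (G : seq (formula n)) : derivable Th G (FTop n)
| d_botE n (G : seq (formula n)) p :
    derivable Th G (FBot n) -> derivable Th G p
| d_andI n (G : seq (formula n)) (I : Type) (p : I -> formula n) :
    (forall i, derivable Th G (p i)) -> derivable Th G (FAnd p)
| d_andE n (G : seq (formula n)) (I : Type) (p : I -> formula n) i :
    derivable Th G (FAnd p) -> derivable Th G (p i)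
| d_orI n (G : seq (formula n)) (I : Type) (p : I -> formula n) i :
    derivable Th G (p i) -> derivable Th G (FOr p)
| d_orE n (G : seq (formula n)) (I : Type) (p : I -> formula n) q :
    derivable Th G (FOr p) -> (forall i, derivable Th (p i :: G) q) ->
    derivable Th G q
| d_impI n (G : seq (formula n)) p q :
    derivable Th (p :: G) q -> derivable Th G (FImp p q)
| d_impE n (G : seq (formula n)) p q :
    derivable Th G (FImp p q) -> derivable Th G p -> derivable Th G q
| d_allI n (G : seq (formula n)) (p : formula n.+1) :
    derivable Th (map (@fshift n) G) p -> derivable Th G (FAll p)
| d_allE n (G : seq (formula n)) (p : formula n.+1) (t : term 'I_n) :
    derivable Th G (FAll p) -> derivable Th G (finst p t)
| d_exI n (G : seq (formula n)) (p : formula n.+1) (t : term 'I_n) :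
    derivable Th G (finst p t) -> derivable Th G (FEx p)
| d_exE n (G : seq (formula n)) (p : formula n.+1) q :
    derivable Th G (FEx p) ->
    derivable Th (p :: map (@fshift n) G) (fshift q) -> derivable Th G q
| d_eqI n (G : seq (formula n)) (t : term 'I_n) : derivable Th G (FEq t t)
| d_eqE n (G : seq (formula n)) (p : formula n.+1) (t u : term 'I_n) :
    derivable Th G (FEq t u) -> derivable Th G (finst p t) ->
    derivable Th G (finst p u).

Definition xvars n m : 'I_n -> term 'I_(n + m) := fun i => Var (lshift m i).
Definition yvars n m : 'I_m -> term 'I_(n + m) := fun i => Var (rshift n i).

Definition feqs n k (s t : 'I_k -> term 'I_n) : formula n :=
  FAnd (fun i => FEq (s i) (t i)).

Inductive Tplus (T : set coherent_axiom) : formula 0 -> Prop :=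
| Tplus_T a : T a -> Tplus T (coherent_formula a)
| Tplus_refl :
    Tplus T (@all_block 1 (FEq (Var (inord 0)) (Var (inord 0))))
| Tplus_sym :
    Tplus T (@all_block 2 (FImp (FEq (Var (inord 0)) (Var (inord 1)))
                                (FEq (Var (inord 1)) (Var (inord 0)))))
| Tplus_trans :
    Tplus T (@all_block 3 (FImp (FEq (Var (inord 0)) (Var (inord 1)))
                          (FImp (FEq (Var (inord 1)) (Var (inord 2)))
                                (FEq (Var (inord 0)) (Var (inord 2))))))
| Tplus_fun (f : funsym S) :
    Tplus T (all_block (FImp (feqs (@xvars _ _) (@yvars _ _))
      (FEq (App (f:=f) (@xvars _ _)) (App (f:=f) (@yvars _ _)))))
| Tplus_rel (p : relsym S) :
    Tplus T (all_block (FImp (feqs (@xvars _ _) (@yvars _ _))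
      (FImp (FAtom (Atom (p:=p) (@xvars _ _)))
            (FAtom (Atom (p:=p) (@yvars _ _))))))
| Tplus_I (f g : funsym S) : f <> g ->
    Tplus T (all_block (FImp
      (FEq (App (f:=f) (@xvars _ _)) (App (f:=g) (@yvars _ _))) (FBot _)))
| Tplus_II (f : funsym S) :
    Tplus T (all_block (FImp
      (FEq (App (f:=f) (@xvars _ _)) (App (f:=f) (@yvars _ _)))
      (feqs (@xvars _ _) (@yvars _ _))))
| Tplus_III n (x : 'I_n) (f : funsym S) (s : 'I_(fun_arity f) -> term 'I_n) :
    (exists i, occurs x (s i)) ->
    Tplus T (all_block (FImp (FEq (Var x) (App s)) (FBot n))).

(* The variables of conditions are natural numbers, and Tm(X) is [term X]. *)
Record cond := Cond {
  cvars : {fset nat};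
  catoms : set (atom cvars);
  catoms_fin : finite_set catoms }.
Arguments catoms : clear implicits.

Definition empty_cond : cond := Cond (finite_set0 (atom (fset0 : {fset nat}))).

Inductive cat_kind := Crn | Cvs | Cts.

Definition kind_ok (K : cat_kind) X Y (f : X -> term Y) : Prop :=
  match K with
  | Crn => exists2 g : X -> Y, injective g & f =1 (fun x => Var (g x))
  | Cvs => exists g : X -> Y, f =1 (fun x => Var (g x))
  | Cts => True
  end.

(* [hom K D C] is the set of morphisms D -> C. *)
Record hom (K : cat_kind) (D C : cond) := Hom {
  hmap :> cvars C -> term (cvars D);
  hom_kind : kind_ok K hmap;
  hom_atoms : asubst hmap @` catoms C `<=` catoms D }.

Lemma kind_ok_Var K X : kind_ok K (@Var X).
Proof. by case: K => //=; exists id. Qed.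

Lemma kind_ok_comp K X Y Z (f : X -> term Y) (g : Y -> term Z) :
  kind_ok K f -> kind_ok K g -> kind_ok K (fun x => tsubst g (f x)).
Proof.
case: K => //= [[f' If Ef] [g' Ig Eg]|[f' Ef] [g' Eg]].
  by exists (g' \o f') => [|x]; [exact: inj_comp | rewrite Ef /= Eg].
by exists (g' \o f') => x; rewrite Ef /= Eg.
Qed.

Lemma hid_atoms (C : cond) : asubst (@Var _) @` catoms C `<=` catoms C.
Proof. by move=> _ [a Ca <-]; rewrite asubst_Var. Qed.

Definition hid K C : hom K C C := Hom (kind_ok_Var K (cvars C)) (@hid_atoms C).

Lemma hcomp_atoms K (E D C : cond) (f : hom K D C) (g : hom K E D) :
  asubst (fun x => tsubst g (f x)) @` catoms C `<=` catoms E.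
Proof.
move=> _ [a Ca <-]; rewrite -asubst_comp.
by apply: (hom_atoms (h:=g)); exists (asubst f a) => //; apply: hom_atoms; exists a.
Qed.

Definition hcomp K (E D C : cond) (f : hom K D C) (g : hom K E D) : hom K E C :=
  Hom (kind_ok_comp (hom_kind f) (hom_kind g)) (hcomp_atoms (f:=f) (g:=g)).

Definition is_iso K (D C : cond) (f : hom K D C) : Prop :=
  exists g : hom K C D, hcomp f g =1 hid K C /\ hcomp g f =1 hid K D.

Record mor_to (K : cat_kind) (C : cond) := MorTo {
  mdom : cond;
  mor :> hom K mdom C }.

Definition postcomp K D C (e : hom K D C) (g : mor_to K D) : mor_to K C :=
  MorTo (hcomp e g).

Section Extension.
Variables (C : cond) (n k : nat).
Variables (v : 'I_k -> nat) (s : 'I_n -> term (cvars C)).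
Variable phi : seq (atom 'I_(k + n)).

Definition ext_vars : {fset nat} :=
  (cvars C `|` [fset v j | j in 'I_k])%fset.

Definition ext_incl : cvars C -> term ext_vars :=
  fun x => Var (fincl (fsubsetUl _ _) x).

Lemma ext_new_subproof j : v j \in ext_vars.
Proof. by apply/fsetUP; right; apply/imfsetP; exists j. Qed.

Definition ext_new (j : 'I_k) : ext_vars := [` ext_new_subproof j]%fset.

Definition ext_inst : 'I_(k + n) -> term ext_vars :=
  sapp (fun j => Var (ext_new j)) (fun i => tsubst ext_incl (s i)).

Definition ext_atoms : set (atom ext_vars) :=
  asubst ext_incl @` catoms C `|` asubst ext_inst @` [set a | List.In a phi].

Lemma ext_atoms_fin : finite_set ext_atoms.
Proof.
rewrite finite_setU; split; apply: finite_image; first exact: catoms_fin.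
elim: phi => [|a l IH] /=.
  by rewrite (_ : [set _ | _] = set0) //; apply/seteqP; split.
rewrite (_ : [set _ | _] = [set a] `|` [set b | List.In b l]).
  by rewrite finite_setU; split=> //; exact: finite_set1.
by apply/seteqP; split=> b /= [->|]; auto.
Qed.

(* The condition (X, v; A, phi), where the last k + n variables of phi are
   interpreted by the names v and the terms s. *)
Definition ext_cond : cond := Cond ext_atoms_fin.

Lemma ext_incl_kind K : kind_ok K ext_incl.
Proof.
by case: K => //=; exists (fincl (fsubsetUl _ _)) => // x y /(congr1 val) /= /val_inj.
Qed.

Lemma ext_incl_atoms : asubst ext_incl @` catoms C `<=` catoms ext_cond.
Proof. by move=> a Ca; left. Qed.

Definition ext_hom K : hom K ext_cond C := @Hom K ext_cond C ext_incl (ext_incl_kind K) ext_incl_atoms.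

End Extension.

Inductive cov (K : cat_kind) (T : set coherent_axiom) :
    forall C : cond, set (mor_to K C) -> Prop :=
| cov_iso D C (f : hom K D C) : is_iso f -> cov T [set MorTo f]
| cov_ax C (a : coherent_axiom) (s : 'I_(ca_n a) -> term (cvars C))
    (v : forall i : 'I_(ca_m a), 'I_(ca_k i) -> nat)
    (U : forall i, set (mor_to K (ext_cond (v i) s (ca_concl i)))) :
    T a ->
    (forall p, List.In p (ca_prem a) -> catoms C (asubst s p)) ->
    (forall i, injective (v i)) ->
    (forall i j, v i j \notin cvars C) ->
    (forall i, cov T (U i)) ->
    cov T (\bigcup_i (postcomp (ext_hom (v i) s (ca_concl i) K) @` U i)).

(* [forces K T p C r] is the forcing C ||- p r, where r assigns terms of Tm(C)
   to the free variables of p. *)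
Fixpoint forces (K : cat_kind) (T : set coherent_axiom) n (p : formula n) :
    forall C : cond, ('I_n -> term (cvars C)) -> Prop :=
  match p in formula n
    return forall C : cond, ('I_n -> term (cvars C)) -> Prop with
  | FTop _ => fun C r => True
  | FBot _ => fun C r => @cov K T C set0
  | FAtom _ a => fun C r => exists2 U : set (mor_to K C), cov T U &
      forall f, U f -> catoms (mdom f) (asubst f (asubst r a))
  | FEq _ t u => fun C r => exists2 U : set (mor_to K C), cov T U &
      forall f, U f -> tsubst f (tsubst r t) = tsubst f (tsubst r u)
  | FAnd _ J q => fun C r => forall i, forces K T (q i) r
  | FOr _ J q => fun C r => exists2 U : set (mor_to K C), cov T U &
      forall f, U f -> exists i, forces K T (q i) (fun x => tsubst f (r x))
  | FImp _ q1 q2 => fun C r => forall D (f : hom K D C),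
      forces K T q1 (fun x => tsubst f (r x)) ->
      forces K T q2 (fun x => tsubst f (r x))
  | FAll _ q => fun C r => forall D (f : hom K D C) (t : term (cvars D)),
      forces K T q (scons t (fun x => tsubst f (r x)))
  | FEx _ q => fun C r => exists2 U : set (mor_to K C), cov T U &
      forall f, U f -> exists t : term (cvars (mdom f)),
        forces K T q (scons t (fun x => tsubst f (r x)))
  end.

End Syntax.

(* Main.v *)
Require Import Defs.
From Stdlib Require List.
From mathcomp Require Import all_boot finmap.
From mathcomp Require Import boolp classical_sets functions cardinality.

(* To prove [prem -> concl] in T+, unify the equations of [prem]: derivable
   equality is a congruence on terms that the constructor axioms make injective,
   disjoint and acyclic, so (unless bot is derivable) the variables can be
   resolved along it to a substitution s with x = s x derivable and with
   t s = u s syntactically whenever t = u is derivable. The condition D whose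
   atoms are those of [prem] under s then forces [prem s], hence [concl s]. As
   [concl] is built from atoms and equations by conjunction, disjunction and
   existential quantification, induction on covers turns its forcing into a
   derivation from the atoms of D, and x = s x gives back [concl]. *)

Set Implicit Arguments.
Unset Strict Implicit.
Unset Printing Implicit Defensive.

Local Open Scope classical_set_scope.

(** * Simultaneous substitution on de Bruijn terms and formulas *)

Section Substitution.
Variable S : signature.

Lemma scons0 A n (t : A) (r : 'I_n -> A) : scons t r ord0 = t.
Proof. by rewrite /scons unlift_none. Qed.

Lemma sconsS A n (t : A) (r : 'I_n -> A) i : scons t r (lift ord0 i) = r i.
Proof. by rewrite /scons liftK. Qed.

Lemma ord_lift0P n (P : 'I_n.+1 -> Prop) :
  P ord0 -> (forall i, P (lift ord0 i)) -> forall i, P i.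
Proof. by move=> P0 PS i; case: (unliftP ord0 i) => [j|] ->. Qed.

Lemma scons_comp A B n (h : A -> B) (t : A) (r : 'I_n -> A) :
  (fun i => h (scons t r i)) = scons (h t) (fun i => h (r i)).
Proof. by apply/funext; apply: ord_lift0P => [|i]; rewrite ?scons0 ?sconsS. Qed.

Lemma scons_eta A n (r : 'I_n.+1 -> A) :
  scons (r ord0) (fun i => r (lift ord0 i)) = r.
Proof. by apply/funext; apply: ord_lift0P => [|i]; rewrite ?scons0 ?sconsS. Qed.

Lemma sapp_comp A B k n (h : A -> B) (r' : 'I_k -> A) (r : 'I_n -> A) :
  (fun i => h (sapp r' r i)) = sapp (fun i => h (r' i)) (fun i => h (r i)).
Proof. by apply/funext => i; rewrite /sapp; case: fintype.split. Qed.

Lemma sapp_lshift A k n (r' : 'I_k -> A) (r : 'I_n -> A) i :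
  sapp r' r (lshift n i) = r' i.
Proof. by rewrite /sapp; case: split_ordP => j // /eqP; rewrite ?eq_shift // => /eqP ->. Qed.

Lemma sapp_rshift A k n (r' : 'I_k -> A) (r : 'I_n -> A) i :
  sapp r' r (rshift k i) = r i.
Proof. by rewrite /sapp; case: split_ordP => j // /eqP; rewrite ?eq_shift // => /eqP ->. Qed.

Lemma tsubst_xvars V n m (a : 'I_n -> term S V) (b : 'I_m -> term S V) :
  (fun i => tsubst (sapp a b) (@xvars S n m i)) = a.
Proof. by apply/funext => i; exact: sapp_lshift. Qed.

Lemma tsubst_yvars V n m (a : 'I_n -> term S V) (b : 'I_m -> term S V) :
  (fun i => tsubst (sapp a b) (@yvars S n m i)) = b.
Proof. by apply/funext => i; exact: sapp_rshift. Qed.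

(** Lets a block of variables be peeled off one binder at a time; [k.+1 + n] and [(k + n).+1] are
    convertible. *)
Lemma sapp_scons A k n (t : A) (r' : 'I_k -> A) (r : 'I_n -> A) :
  sapp (scons t r') r = scons t (sapp r' r) :> ('I_(k.+1 + n) -> A).
Proof.
apply/funext; apply: (@ord_lift0P (k + n)) => [|i].
  rewrite (_ : ord0 = lshift n ord0); last exact: val_inj.
  by rewrite sapp_lshift scons0 (_ : lshift n ord0 = ord0) ?scons0 //; apply: val_inj.
rewrite sconsS; case: (split_ordP i) => j ->.
  rewrite (_ : lift _ _ = lshift n (lift ord0 j)); last exact: val_inj.
  by rewrite !sapp_lshift sconsS.
rewrite (_ : lift _ _ = rshift k.+1 j); last exact: val_inj.
by rewrite !sapp_rshift.
Qed.

Lemma sapp0 A n (r' : 'I_0 -> A) (r : 'I_n -> A) : sapp r' r = r.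
Proof.
apply/funext => i; rewrite -[RHS](sapp_rshift r' r); congr sapp.
exact: val_inj.
Qed.

Lemma no_varE A (r : 'I_0 -> A) : r = no_var A.
Proof. by apply/funext => -[]. Qed.

Lemma eq_tsubst_occurs V W (s s' : V -> term S W) (t : term S V) :
  (forall x, occurs x t -> s x = s' x) -> tsubst s t = tsubst s' t.
Proof.
elim: t => [x|f a IH] /= Hs; first exact: Hs.
by congr App; apply/funext => i; apply: IH => x xi; apply: Hs; exists i.
Qed.

Lemma occurs_tsubst V W (s : V -> term S W) (t : term S V) x y :
  occurs x t -> occurs y (s x) -> occurs y (tsubst s t).
Proof.
elim: t => [z|f a IH] /= => [<- //|[i xi] yx].
by exists i; apply: IH.
Qed.

Lemma tsubst_Var_comp V W Z (h : V -> W) (s : W -> term S Z) (t : term S V) :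
  tsubst s (tsubst (fun x => Var S (h x)) t) = tsubst (fun x => s (h x)) t.
Proof. exact: tsubst_comp. Qed.

Lemma tsubst_shift n W (s : 'I_n.+1 -> term S W) (t : term S 'I_n) :
  tsubst s (shift t) = tsubst (fun i => s (lift ord0 i)) t.
Proof. exact: tsubst_comp. Qed.

Lemma tsubst_scons_shift n (t u : term S 'I_n) :
  tsubst (scons t (@Var S _)) (shift u) = u.
Proof.
rewrite tsubst_shift -[RHS]tsubst_Var; congr tsubst.
by apply/funext => i; rewrite sconsS.
Qed.

Lemma up0 n m (s : 'I_n -> term S 'I_m) : up s ord0 = Var S ord0.
Proof. exact: scons0. Qed.

Lemma upS n m (s : 'I_n -> term S 'I_m) i : up s (lift ord0 i) = shift (s i).
Proof. exact: sconsS. Qed.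

Lemma up_comp n m l (s : 'I_n -> term S 'I_m) (r : 'I_m -> term S 'I_l) :
  (fun i => tsubst (up r) (up s i)) = up (fun i => tsubst r (s i)).
Proof.
apply/funext; apply: ord_lift0P => [|i]; first by rewrite !up0 /= up0.
rewrite !upS tsubst_shift /shift tsubst_comp; congr tsubst.
by apply/funext => j; rewrite upS.
Qed.

Lemma fsubst_comp n (p : formula S n) m (s : 'I_n -> term S 'I_m) l
    (r : 'I_m -> term S 'I_l) :
  fsubst (fsubst p s) r = fsubst p (fun i => tsubst r (s i)).
Proof.
elim: p m s l r => {n} /=
  [n|n|n a|n t u|n I q IH|n I q IH|n q IHq q' IHq'|n q IH|n q IH] m s l r.
- by [].
- by [].
- by rewrite asubst_comp.
- by rewrite !tsubst_comp.
- by congr FAnd; apply/funext => i; apply: IH.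
- by congr FOr; apply/funext => i; apply: IH.
- by rewrite IHq IHq'.
- by rewrite IH up_comp.
- by rewrite IH up_comp.
Qed.

Lemma up_Var n : up (@Var S 'I_n) = @Var S 'I_n.+1.
Proof. by apply/funext; apply: ord_lift0P => [|i]; rewrite ?up0 ?upS. Qed.

Lemma fsubst_Var n (p : formula S n) : fsubst p (@Var S _) = p.
Proof.
elim: p => {n} /= [n|n|n a|n t u|n I q IH|n I q IH|n q IHq q' IHq'|n q IH|n q IH].
- by [].
- by [].
- by rewrite asubst_Var.
- by rewrite !tsubst_Var.
- by congr FAnd; apply/funext.
- by congr FOr; apply/funext.
- by rewrite IHq IHq'.
- by rewrite up_Var IH.
- by rewrite up_Var IH.
Qed.

(** The quantifier rules are stated with [finst]; this turns an instantiation into one more value of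
    a simultaneous substitution. *)
Lemma finst_up n m (p : formula S n.+1) (s : 'I_n -> term S 'I_m) t :
  finst (fsubst p (up s)) t = fsubst p (scons t s).
Proof.
rewrite /finst fsubst_comp; congr fsubst.
apply/funext; apply: ord_lift0P => [|i]; first by rewrite up0 /= !scons0.
by rewrite upS sconsS tsubst_scons_shift.
Qed.

End Substitution.

(** * Unifiers of injective, disjoint and acyclic congruences *)

Section Unifier.
Variables (S : signature) (V : finType) (R : term S V -> term S V -> Prop).
Hypothesis R_refl : forall t, R t t.
Hypothesis R_sym : forall t u, R t u -> R u t.
Hypothesis R_trans : forall t u w, R t u -> R u w -> R t w.
Hypothesis R_congr : forall (s s' : V -> term S V) t,
  (forall x, R (s x) (s' x)) -> R (tsubst s t) (tsubst s' t).
Hypothesis R_disj : forall f g a b, R (App (f:=f) a) (App (f:=g) b) -> f = g.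
Hypothesis R_inj : forall f a b, R (App (f:=f) a) (App (f:=f) b) ->
  forall i, R (a i) (b i).
Hypothesis R_acyclic : forall x f (a : 'I_(fun_arity f) -> term S V),
  R (Var S x) (App a) -> ~ (exists i, occurs x (a i)).

Let below (y x : V) :=
  exists f (a : 'I_(fun_arity f) -> term S V),
    R (Var S x) (App a) /\ exists i, occurs y (a i).

Let below_irr x : ~ below x x.
Proof. by move=> [f [a [xa ?]]]; exact: R_acyclic xa _. Qed.

(** In the compound term equal to [x], replace [y] by the compound term equal to it: by congruence
    the result still equals [x], and it contains [z]. *)
Let below_trans x y z : below z y -> below y x -> below z x.
Proof.
move=> [g [b [yb [j zb]]]] [f [a [xa ya]]].
pose th v := if v == y then App b else Var S v.
have thy : th y = App b by rewrite /th eqxx.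
have Rth t : R t (tsubst th t).
  rewrite -[X in R X _]tsubst_Var; apply: R_congr => v.
  by rewrite /th; case: eqP => [->|].
exists f, (fun i => tsubst th (a i)); split; first exact: R_trans xa (Rth _).
case: ya => i yi; exists i; apply: occurs_tsubst yi _.
by rewrite thy; exists j.
Qed.

Let rank x := #|[set y | `[< below y x >]]%SET|.

(** Transitivity gives the inclusion of the sets counted; it is strict because [y] is below [x] but
    not below itself. *)
Let rank_lt y x : below y x -> (rank y < rank x)%N.
Proof.
move=> yx; apply: proper_card; apply/properP; split.
  by apply/fintype.subsetP => z; rewrite !inE => zy; exact: below_trans zy yx.
by exists y; rewrite !inE //; apply/negP => /asboolW/below_irr.
Qed.

Lemma congruence_unifier : exists s : V -> term S V,
  (forall x, R (Var S x) (s x)) /\ forall t u, R t u -> tsubst s t = tsubst s u.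
Proof.
pose rep x := odflt x [pick y | `[< R (Var S x) (Var S y) >]].
have repR x : R (Var S x) (Var S (rep x)).
  by rewrite /rep; case: pickP => [y /asboolP|] //= _; exact: R_refl.
(* R-equal variables give the same predicate to [pick], and by reflexivity the defaults [x] and [y]
   are never reached. *)
have repE x y : R (Var S x) (Var S y) -> rep x = rep y.
  move=> xy; rewrite /rep.
  have /eq_pick -> : (fun z => `[< R (Var S x) (Var S z) >]) =1
      (fun z => `[< R (Var S y) (Var S z) >]).
    move=> z; apply/asboolP/asboolP; first exact: R_trans (R_sym xy).
    exact: R_trans xy.
  by case: pickP => // /(_ y) /asboolP; case; exact: R_refl.
have /choice [g gP] y : exists t, R (Var S y) t /\
    ((exists f (a : 'I_(fun_arity f) -> term S V), t = App a) \/
     t = Var S y /\ forall f (a : 'I_(fun_arity f) -> term S V), ~ R (Var S y) (App a)).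
  case: (pselect (exists f (a : 'I_(fun_arity f) -> term S V), R (Var S y) (App a))).
    by move=> [f [a ya]]; exists (App a); split=> //; left; exists f, a.
  move=> nya; exists (Var S y); split; first exact: R_refl.
  by right; split=> // f a ya; apply: nya; exists f, a.
(* [s0 x] is a compound term equal to x if there is one, and otherwise a
   variable; it depends only on the R-class of x. Iterating [s0] stabilizes
   because each step strictly lowers the rank of the variables not yet fixed. *)
pose s0 x := g (rep x).
have s0R x : R (Var S x) (s0 x) by apply: R_trans (repR x) _; case: (gP (rep x)).
have s0E x y : R (Var S x) (Var S y) -> s0 x = s0 y by rewrite /s0 => /repE ->.
have s0App x f (a : 'I_(fun_arity f) -> term S V) : R (Var S x) (App a) ->
    exists b : 'I_(fun_arity f) -> term S V, s0 x = App b /\ forall i, R (a i) (b i).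
  move=> xa; case: (gP (rep x)) (s0R x) => _ [[h [b Eb]]|[_ /(_ f a) []]]; last first.
    exact: R_trans (R_sym (repR x)) xa.
  rewrite /s0 Eb => xb.
  have ab := R_trans (R_sym xa) xb; have fh := R_disj ab.
  by case: h / fh b {Eb xb} ab => b ab; exists b; split=> //; exact: R_inj ab.
(* A compound value has only variables below [x]; a variable value lies in the class of [x], hence
   is fixed by [s0]. *)
have s0below x y : occurs y (s0 x) -> below y x \/ s0 y = Var S y.
  case: (gP (rep x)) (s0R x); rewrite -/(s0 x) => _ [[f [a ->]]|[Ex nx]] xy.
    by move=> ya; left; exists f, a.
  rewrite Ex /= => ->; right; rewrite (@s0E _ x) //; exact: R_sym.
pose fix s k : V -> term S V :=
  if k is k'.+1 then fun x => tsubst (s k') (s0 x) else @Var S V.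
have s_fix x k : s0 x = Var S x -> s k x = Var S x.
  by move=> Ex; elim: k => //= k IH; rewrite Ex.
have s_stable k x : (rank x < k)%N -> s k x = s k.+1 x.
  elim: k x => // k IH x xk; apply: eq_tsubst_occurs => y /s0below [yx|Ey].
    by apply: IH; exact: leq_trans (rank_lt yx) xk.
  exact: etrans (s_fix y k Ey) (esym (s_fix y k.+1 Ey)).
(* [#|V|.+1] exceeds every rank, so all variables are stable by then and [sg] absorbs one further
   step [s0]. *)
pose sg := s #|V|.+1.
have sgE x : sg x = tsubst sg (s0 x).
  by rewrite /sg s_stable // ltnS; exact: max_card.
exists sg; split.
  rewrite /sg => x; elim: (#|V|.+1) x => [|k IH] x /=; first exact: R_refl.
  apply: R_trans (s0R x) _; rewrite -[X in R X _]tsubst_Var.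
  exact: R_congr.
(* Replacing a variable by the compound term it equals makes [t] and [u] grow but
   leaves their instance [w] unchanged, so the induction is on [w]. *)
have head t :
    (exists f (a : 'I_(fun_arity f) -> term S V),
       R t (App a) /\ tsubst sg t = tsubst sg (App a)) \/
    (exists x, t = Var S x /\ forall f (a : 'I_(fun_arity f) -> term S V),
       ~ R (Var S x) (App a)).
  case: t => [x|f a]; last by left; exists f, a; split.
  case: (pselect (exists f (a : 'I_(fun_arity f) -> term S V), R (Var S x) (App a))).
    move=> [f [a xa]]; left; have [b [Eb _]] := s0App _ _ _ xa.
    by exists f, b; rewrite -Eb -sgE; split.
  by move=> nx; right; exists x; split=> // f a xa; apply: nx; exists f, a.
pose P w := forall t u, R t u -> tsubst sg t = w -> tsubst sg u = w.
suff main w : P w by move=> t u tu; rewrite (main _ _ _ tu erefl).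
pose subterms_P (w : term S V) := if w is App f a then forall i, P (a i) else True.
have step v : subterms_P v -> P v.
  move=> Pv t u tu tv.
  (* Two compound terms share their head and have R-equal arguments; a variable equal to no compound
     term cannot meet one; two such variables have the same [s0]. *)
  case: (head t) (head u) => [[f [a [ta Ea]]]|[x [Ex nx]]] [[h [b [ub Eb]]]|[y [Ey ny]]].
  - have ab := R_trans (R_sym ta) (R_trans tu ub); have fh := R_disj ab.
    case: h / fh b ub Eb ab => b ub Eb ab.
    rewrite -tv Ea /= in Pv; rewrite Eb -tv Ea /=; congr App; apply/funext => i.
    exact: Pv (R_inj ab i) erefl.
  - by case: (ny f a); rewrite -Ey; exact: R_trans (R_sym tu) ta.
  - by case: (nx h b); rewrite -Ex; exact: R_trans tu ub.
  - by rewrite -tv Ex Ey /= !(sgE x, sgE y) (@s0E x y) // -Ex -Ey.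
by elim: w => [z|f w IH]; apply: step.
Qed.

End Unifier.

(** * Derived rules over an arbitrary theory *)

Section Derivations.
Variables (S : signature) (Th : formula S 0 -> Prop).
Local Notation derivable := (derivable Th).

(** Each member of [L] becomes the premise of an implication that is then eliminated, so no
    induction on derivations is involved. *)
Lemma derivable_cut n (L G : seq (formula S n)) q :
  (forall p, List.In p L -> derivable G p) -> derivable (L ++ G) q -> derivable G q.
Proof.
elim: L q => [|p L IH] q //= HL Hq.
apply: (@d_impE _ _ _ _ p); last by apply: HL; left.
by apply: IH => [p' Lp'|]; [apply: HL; right | exact: d_impI].
Qed.

Lemma derivable_fin_conjI n (l : seq (formula S n)) m (s : 'I_n -> term S 'I_m) G :
  (forall p, List.In p l -> derivable G (fsubst p s)) ->
  derivable G (fsubst (fin_conj l) s).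
Proof.
move=> H; apply: d_andI => i; apply: H; case: i => i /=.
by elim: l i => [|p l IH] [|i] //=; [left | right; exact: IH].
Qed.

Lemma derivable_fin_conjE n (l : seq (formula S n)) m (s : 'I_n -> term S 'I_m) G p :
  derivable G (fsubst (fin_conj l) s) -> List.In p l -> derivable G (fsubst p s).
Proof.
move=> H lp; suff [i il <-] : exists2 i, (i < size l)%N & nth (FTop S n) l i = p.
  exact: (d_andE (Ordinal il) H).
elim: l lp {H} => //= p' l IH [->|/IH [i il Ei]]; first by exists 0.
by exists i.+1.
Qed.

Lemma derivable_all_blockI n (p : formula S n) :
  derivable [::] p -> derivable [::] (all_block p).
Proof. by elim: n p => //= n IH p Hp; apply: IH; exact: d_allI. Qed.

Lemma derivable_all_blockE n (p : formula S n) m (s : 'I_n -> term S 'I_m) G :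
  derivable G (fsubst (all_block p) (@no_var _)) -> derivable G (fsubst p s).
Proof.
elim: n p s => [|n IH] p s /=; first by rewrite (no_varE s).
move=> /(IH _ (fun i => s (lift ord0 i))) /= /(d_allE (s ord0)).
by rewrite finst_up scons_eta.
Qed.

Lemma derivable_axiom n (p : formula S n) m (s : 'I_n -> term S 'I_m) G :
  Th (all_block p) -> derivable G (fsubst p s).
Proof. by move=> /d_ax H; exact: derivable_all_blockE. Qed.

(* Eliminating a block of existentials moves the derivation to more variables:
   [w] renames the old ones, [v] lists the witnesses. *)
Lemma derivable_ex_blockE k n (p : formula S (k + n)) m (s : 'I_n -> term S 'I_m) G q :
  derivable G (fsubst (ex_block p) s) ->
  (forall m' (w : 'I_m -> term S 'I_m') (v : 'I_k -> term S 'I_m') G',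
     (forall g, List.In g G -> List.In (fsubst g w) G') ->
     List.In (fsubst p (sapp v (fun i => tsubst w (s i)))) G' ->
     derivable G' (fsubst q w)) ->
  derivable G q.
Proof.
elim: k p => [|k IH] p /= Hp Hq.
  apply: (@derivable_cut _ [:: fsubst p s]); first by move=> _ [<-|[]].
  rewrite -[q]fsubst_Var; apply: (Hq _ _ (@no_var _)) => [g Gg|/=].
    by rewrite fsubst_Var; right.
  left; rewrite sapp0; congr fsubst.
  by apply/funext => i; rewrite tsubst_Var.
apply: (IH _ Hp) => m' w v G' GG' /= G'p.
apply: (d_exE (d_hyp _ G'p)); rewrite /fshift fsubst_comp.
(* The eigenvariable just introduced is index 0 of the block; the other witnesses are shifted past
   it. *)
apply: (Hq _ _ (scons (Var S ord0) (fun i => shift (v i)))) => [g /GG' G'g|].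
  right; rewrite -(fsubst_comp g).
  exact: (List.in_map (@fshift S m') _ _ G'g).
left; congr fsubst; rewrite sapp_scons /up; congr scons; rewrite sapp_comp.
by congr sapp; apply/funext => i; rewrite /shift tsubst_comp.
Qed.

(** [d_eqE] rewrites a single variable, so [s] is changed into [s'] one index at a time; [h j] has
    already been changed below [j]. *)
Lemma derivable_leibniz m G n (p : formula S n) (s s' : 'I_n -> term S 'I_m) :
  (forall i, derivable G (FEq (s i) (s' i))) ->
  derivable G (fsubst p s) -> derivable G (fsubst p s').
Proof.
move=> ss' Hp; pose h j (i : 'I_n) := if (i < j)%N then s' i else s i.
have Hh j : (j <= n)%N -> derivable G (fsubst p (h j)).
  elim: j => [_|j IH jn]; first by rewrite (_ : h 0 = s).
  (* [th] leaves position [j] open as variable 0, so that [h j] and [h j.+1] are both instances of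
     it. *)
  pose th (i : 'I_n) := if i == j :> nat then Var S ord0 else shift (h j i).
  have thE t i : tsubst (scons t (@Var S _)) (th i) =
      if i == j :> nat then t else h j i.
    by rewrite /th; case: eqP => _ /=; rewrite ?scons0 ?tsubst_scons_shift.
  move: (IH (ltnW jn)).
  have -> : fsubst p (h j) = finst (fsubst p th) (s (Ordinal jn)).
    rewrite /finst fsubst_comp; congr fsubst; apply/funext => i; rewrite thE.
    case: eqP => // ij; rewrite /h ij ltnn; congr s; exact: val_inj.
  move=> /(d_eqE (ss' (Ordinal jn))).
  rewrite /finst fsubst_comp; congr (derivable G (fsubst p _)).
  apply/funext => i; rewrite thE /h ltnS [(i <= j)%N]leq_eqVlt.
  by case: eqP => //= ij; congr s'; exact: val_inj.
suff <- : h n = s' by exact: Hh.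
by apply/funext => i; rewrite /h ltn_ord.
Qed.

Lemma derivable_eq_sym n G (t u : term S 'I_n) :
  derivable G (FEq t u) -> derivable G (FEq u t).
Proof.
move=> tu; have := @d_eqE _ Th _ G (FEq (Var S ord0) (shift t)) t u tu.
by rewrite /finst /= !scons0 !tsubst_scons_shift; apply; exact: d_eqI.
Qed.

Lemma derivable_eq_trans n G (t u w : term S 'I_n) :
  derivable G (FEq t u) -> derivable G (FEq u w) -> derivable G (FEq t w).
Proof.
move=> tu uw; have := @d_eqE _ Th _ G (FEq (shift t) (Var S ord0)) u w uw.
by rewrite /finst /= !scons0 !tsubst_scons_shift; apply.
Qed.

(** Leibniz for an equation in [m + n] variables: the first [m] carry the fixed left side, the last
    [n] pass from [s] to [s'], starting from reflexivity. *)
Lemma derivable_eq_tsubst m G n (t : term S 'I_n) (s s' : 'I_n -> term S 'I_m) :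
  (forall i, derivable G (FEq (s i) (s' i))) ->
  derivable G (FEq (tsubst s t) (tsubst s' t)).
Proof.
move=> ss'.
pose p : formula S (m + n) :=
  FEq (tsubst (fun i => Var S (lshift n i)) (tsubst s t))
      (tsubst (fun i => Var S (rshift m i)) t).
have pE r : fsubst p (sapp (@Var S _) r) = FEq (tsubst s t) (tsubst r t).
  rewrite /p /= !tsubst_Var_comp; congr FEq.
    rewrite -[RHS]tsubst_Var; congr tsubst.
    by apply/funext => i; rewrite sapp_lshift.
  by congr tsubst; apply/funext => i; rewrite sapp_rshift.
rewrite -pE; apply: (@derivable_leibniz _ _ _ _ (sapp (@Var S _) s)).
  move=> i; case: (split_ordP i) => j ->.
    by rewrite !sapp_lshift; exact: d_eqI.
  by rewrite !sapp_rshift.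
by rewrite pE; exact: d_eqI.
Qed.

End Derivations.

Local Arguments catoms {S} c _.

(** * Unifiers from the constructor axioms *)

Section Main.
Variables (S : signature) (T : set (coherent_axiom S)).
Local Notation derivable := (derivable (Tplus T)).

(** If bot is not derivable, axioms (I) and (III) make derivable equality disjoint and acyclic by
    contradiction; axiom (II) makes it injective. *)
Lemma derivable_unifier n (G : seq (formula S n)) :
  derivable G (FBot S n) \/
  exists s : 'I_n -> term S 'I_n,
    (forall x, derivable G (FEq (Var S x) (s x))) /\
    forall t u, derivable G (FEq t u) -> tsubst s t = tsubst s u.
Proof.
case: (pselect (derivable G (FBot S n))) => [|nbot]; [by left | right].
apply: congruence_unifier.
- exact: d_eqI.
- exact: derivable_eq_sym.
- exact: derivable_eq_trans.
- by move=> s s' t; exact: derivable_eq_tsubst.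
- move=> f g a b ab; apply: contrapT => fg; apply: nbot.
  have := derivable_axiom (sapp a b) G (Tplus_I T fg).
  by rewrite /= tsubst_xvars tsubst_yvars => /d_impE; apply.
- move=> f a b ab i.
  have := derivable_axiom (sapp a b) G (Tplus_II T f).
  rewrite /= tsubst_xvars tsubst_yvars => /d_impE /(_ ab) /(d_andE i) /=.
  by rewrite sapp_lshift sapp_rshift.
- move=> x f a xa occ; apply: nbot.
  have := derivable_axiom (@Var S _) G (Tplus_III T occ).
  by rewrite fsubst_Var => /d_impE; apply.
Qed.

(* [entails C p r]: p r is derivable from the atoms of C. Quantifying over all
   interpretations [s] of the variables of C in a context, with the atoms as
   hypotheses, builds closure under substitution and weakening in. *)
Definition entails (C : cond S) n (p : formula S n)
    (r : 'I_n -> term S (cvars C)) : Prop :=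
  forall m (G : seq (formula S m)) (s : cvars C -> term S 'I_m),
    (forall a, catoms C a -> List.In (FAtom (asubst s a)) G) ->
    derivable G (fsubst p (fun i => tsubst s (r i))).

(** * Derivability from a condition is local for covers *)

Variable K : cat_kind.

(** The axiom instance is itself derivable in T+; in each disjunct its eigenvariables interpret the
    fresh names of the extended condition. *)
Lemma entails_ext (C : cond S) (a : coherent_axiom S)
    (s : 'I_(ca_n a) -> term S (cvars C)) (v : forall i : 'I_(ca_m a), 'I_(ca_k i) -> nat)
    n (p : formula S n) r :
  T a ->
  (forall p, List.In p (ca_prem a) -> catoms C (asubst s p)) ->
  (forall i, injective (v i)) ->
  (forall i j, v i j \notin cvars C) ->
  (forall i, @entails (ext_cond (v i) s (ca_concl i)) _ p
     (fun x => tsubst (ext_incl (v i)) (r x))) ->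
  @entails C _ p r.
Proof.
move=> Ta prem vI vC IH m G h hG.
have prem_h : derivable G
    (fsubst (fin_conj (map (@FAtom _ _) (ca_prem a))) (fun i => tsubst h (s i))).
  apply: derivable_fin_conjI => q /List.in_map_iff [b [<- /prem /hG]].
  by rewrite asubst_comp => /d_hyp.
have /d_impE /(_ prem_h) /d_orE := derivable_axiom (fun i => tsubst h (s i)) G (Tplus_T Ta).
apply=> i; apply: derivable_ex_blockE; first by apply: d_hyp; left.
move=> m' w w' G' GG' G'c.
(* [h'] extends [h] to the new names: freshness keeps old and new names apart, and injectivity of
   [v i] gives each new name a single witness. *)
have /choice [h' h'E] (y : ext_vars C (v i)) : exists t,
    (forall x, val x = val y -> t = tsubst w (h x)) /\
    (forall j, v i j = val y -> t = w' j).
  case/fsetUP: (valP y) => [yC|/imfsetP [j _ yv]].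
    exists (tsubst w (h [` yC]%fset)); split=> [x xy|j vy].
      by congr (tsubst w (h _)); apply: val_inj.
    by move: (vC i j); rewrite vy yC.
  exists (w' j); split=> [x xy|j' vy].
    by move: (vC i j); rewrite -yv -xy (valP x).
  by congr w'; apply: vI; rewrite vy yv.
have h'incl (t : term S (cvars C)) :
    tsubst h' (tsubst (ext_incl (v i)) t) = tsubst w (tsubst h t).
  by rewrite !tsubst_comp; congr tsubst; apply/funext => x; apply: (h'E _).1.
have h'inst : (fun x => tsubst h' (ext_inst (v i) s x)) =
    sapp w' (fun j => tsubst w (tsubst h (s j))).
  rewrite (sapp_comp (tsubst h')); congr sapp; apply/funext => j.
    exact: (h'E _).2.
  exact: h'incl.
rewrite fsubst_comp (_ : (fun j => _) = fun j => tsubst h' (tsubst (ext_incl (v i)) (r j)));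
  last by apply/funext => j; rewrite h'incl.
pose c_inst (b : atom S 'I_(ca_k i + ca_n a)) :=
  FAtom (asubst (sapp w' (fun j => tsubst w (tsubst h (s j)))) b).
(* [entails] wants the atoms literally in the context, whereas [G'] holds the new ones only as one
   conjunction. *)
apply: (derivable_cut (L := map c_inst (ca_concl i))).
  move=> _ /List.in_map_iff [b [<- ab]].
  apply: (derivable_fin_conjE (d_hyp _ G'c) (p := FAtom b)).
  exact: List.in_map.
apply: IH => _ [[b Cb <-]|[b ab <-]]; apply/List.in_or_app; [right | left].
  rewrite asubst_comp; move: (GG' _ (or_intror (hG _ Cb))) => /=; rewrite asubst_comp.
  congr (List.In (FAtom (asubst _ b)) G'); apply/funext => x.
  by move: (h'incl (Var S x)) => /= ->.
apply/List.in_map_iff; exists b; split=> //; rewrite asubst_comp.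
by rewrite h'inst.
Qed.

Lemma entails_cov (C : cond S) (U : set (mor_to K C)) : cov T U ->
  forall n (p : formula S n) r,
    (forall f, U f -> @entails (mdom f) _ p (fun x => tsubst f (r x))) ->
    @entails C _ p r.
Proof.
elim=> {C U} [D C f [g [fg _]]|C a s v U Ta prem vI vC _ IH] n p r Hr.
  move=> m G h hG.
  (* The variables of the isomorphic condition are interpreted through the inverse [g]. *)
  have := Hr _ erefl m G (fun y => tsubst h (g y)).
  rewrite (_ : (fun _ => _) = fun i => tsubst h (r i)).
    apply=> b Db; rewrite -asubst_comp; apply: hG.
    by apply: (hom_atoms (h:=g)); exists b.
  apply/funext => i; rewrite -tsubst_comp; congr tsubst; rewrite tsubst_comp.
  by rewrite -[RHS]tsubst_Var; congr tsubst; apply/funext => x; exact: fg.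
apply: (entails_ext Ta prem vI vC) => i; apply: IH => g Ug.
have := Hr (postcomp (ext_hom (v i) s (ca_concl i) K) g).
rewrite (_ : (fun x => tsubst (postcomp _ g) (r x)) =
  fun x => tsubst g (tsubst (ext_incl (v i)) (r x))).
  by apply; exists i => //; exists g.
by apply/funext => x; rewrite tsubst_comp.
Qed.

(** * From forcing to derivability, for the formulas in conclusions *)

Definition forces_sound n (p : formula S n) :=
  forall (C : cond S) r, forces K T p (C := C) r -> @entails C _ p r.

(** On the cover an atom is a hypothesis and an equation is an instance of reflexivity;
    [entails_cov] carries both back to [C]. *)
Lemma forces_sound_eatom n (e : eatom S n) : forces_sound (eatom_formula e).
Proof.
case: e => [a|t u] C r [U CU HU]; apply: entails_cov CU _ _ _ _ => f Uf m G s hG /=.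
  by apply: d_hyp; rewrite -!asubst_comp; exact: hG (HU f Uf).
by rewrite -!tsubst_comp HU //; exact: d_eqI.
Qed.

Lemma forces_sound_and n I (p : I -> formula S n) :
  (forall i, forces_sound (p i)) -> forces_sound (FAnd p).
Proof. by move=> IH C r Hp m G s hG; apply: d_andI => i; exact: IH. Qed.

Lemma forces_sound_or n I (p : I -> formula S n) :
  (forall i, forces_sound (p i)) -> forces_sound (FOr p).
Proof.
move=> IH C r [U CU HU]; apply: entails_cov CU _ _ _ _ => f Uf m G s hG /=.
by have [i Hi] := HU f Uf; apply: (d_orI (i := i)); exact: IH Hi _ _ _ hG.
Qed.

Lemma forces_sound_ex n (p : formula S n.+1) : forces_sound p -> forces_sound (FEx p).
Proof.
move=> IH C r [U CU HU]; apply: entails_cov CU _ _ _ _ => f Uf m G s hG /=.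
have [t Ht] := HU f Uf; apply: (d_exI (t := tsubst s t)).
by have := IH _ _ Ht _ _ _ hG; rewrite finst_up scons_comp.
Qed.

Lemma forces_sound_ex_block k n (p : formula S (k + n)) :
  forces_sound p -> forces_sound (ex_block p).
Proof. by elim: k p => //= k IH p Hp; apply: IH; exact: forces_sound_ex. Qed.

Lemma forces_sound_fin_conj n (l : seq (eatom S n)) :
  forces_sound (fin_conj (map (@eatom_formula S n) l)).
Proof.
apply: forces_sound_and => -[i il] /=.
elim: l i il => [|e l IH] [|i] //= il; first exact: forces_sound_eatom.
exact: IH.
Qed.

(** * Forcing along morphisms *)

Definition forces_stable n (p : formula S n) :=
  forall (C D : cond S) (f : hom K D C) r,
    forces K T p (C := C) r -> forces K T p (C := D) (fun x => tsubst f (r x)).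

Lemma tsubst_hcomp (E D C : cond S) (f : hom K D C) (g : hom K E D) n
    (r : 'I_n -> term S (cvars C)) :
  (fun x => tsubst (hcomp f g) (r x)) = fun x => tsubst g (tsubst f (r x)).
Proof. by apply/funext => x; rewrite tsubst_comp. Qed.

(** The forcing clause already ranges over all morphisms into the condition, so stability is
    composition. *)
Lemma forces_stable_imp n (p q : formula S n) : forces_stable (FImp p q).
Proof. by move=> C D f r H E g; rewrite -tsubst_hcomp; exact: H. Qed.

Lemma forces_stable_all n (p : formula S n.+1) : forces_stable (FAll p).
Proof. by move=> C D f r H E g t; rewrite -tsubst_hcomp; exact: H. Qed.

Lemma forces_mp (C : cond S) n (p q : formula S n) (r : 'I_n -> term S (cvars C)) :
  forces K T (FImp p q) r -> forces K T p r -> forces K T q r.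
Proof.
have rE : (fun x => tsubst (hid K C) (r x)) = r.
  by apply/funext => x; exact: tsubst_Var.
by move=> /(_ C (hid K C)); rewrite rE.
Qed.

(** The passage along [f] is made once, at the empty block; every quantifier is then instantiated at
    the identity of [D]. *)
Lemma forces_all_block (C D : cond S) (f : hom K D C) n (p : formula S n) r0 r :
  forces_stable p -> forces K T (all_block p) (C := C) r0 -> forces K T p (C := D) r.
Proof.
elim: n p r => [|n IH] p r st /= H.
  rewrite (_ : r = fun x => tsubst f (r0 x)); first exact: st.
  by apply/funext => -[].
have := IH _ (fun i => r (lift ord0 i)) (@forces_stable_all _ p) H D (hid K D) (r ord0).
rewrite (_ : scons _ _ = r) // -[RHS]scons_eta; congr scons.
by apply/funext => i; exact: tsubst_Var.
Qed.

Lemma cov_hid (C : cond S) : cov T [set MorTo (hid K C)].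
Proof. by apply: cov_iso; exists (hid K C). Qed.

(** * The condition of a geometric premise *)

Lemma finite_In (A : Type) (l : seq A) : finite_set [set a | List.In a l].
Proof.
elim: l => [|a l IH] /=.
  by rewrite (_ : [set _ | _] = set0) //; apply/seteqP; split.
rewrite (_ : [set _ | _] = [set a] `|` [set b | List.In b l]).
  by rewrite finite_setU; split=> //; exact: finite_set1.
by apply/seteqP; split=> b /= [->|]; auto.
Qed.

(** Conditions hold no equations: those of the premise are accounted for by the unifier. *)
Definition eatom_atoms n (l : seq (eatom S n)) : seq (atom S 'I_n) :=
  pmap (fun e => if e is EAtom a then Some a else None) l.

Lemma In_eatom_atoms n (l : seq (eatom S n)) a :
  List.In a (eatom_atoms l) <-> List.In (EAtom a) l.
Proof.
elim: l => //= -[b|t u] l IH /=; rewrite IH; split; try by [auto|case].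
  by case=> [->|]; auto.
by case=> [[->]|]; auto.
Qed.

(** Conditions take natural numbers as variables, so a context ['I_n] is copied into a finite set of
    them. *)
Definition ord_names n : {fset nat} := [fset val i | i in 'I_n]%fset.

Lemma ord_name_subproof n (i : 'I_n) : val i \in ord_names n.
Proof. by apply/imfsetP; exists i. Qed.

Definition ord_name n (i : 'I_n) : ord_names n := [` ord_name_subproof i]%fset.

Lemma ord_name_inv n : exists h : ord_names n -> 'I_n, cancel (@ord_name n) h.
Proof.
have /choice [h hE] (y : ord_names n) : exists i, ord_name i = y.
  by case/imfsetP: (valP y) => i _ yi; exists i; exact: val_inj.
by exists h => i; apply: val_inj; exact: (congr1 val (hE (ord_name i))).
Qed.

Lemma forces_geometric (g : geometric_sequent S) :
  forces K T (geometric_formula g) (C := empty_cond S) (@no_var _) ->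
  derivable [::] (geometric_formula g).
Proof.
move=> Hg; apply: derivable_all_blockI; apply: d_impI.
set prem := fin_conj _; set concl := FOr _.
have prem_e e : List.In e (gs_prem g) -> derivable [:: prem] (eatom_formula e).
  move=> ge; rewrite -[eatom_formula e]fsubst_Var.
  apply: (@derivable_fin_conjE _ _ _ (map (@eatom_formula S _) (gs_prem g))).
    by rewrite fsubst_Var; apply: d_hyp; left.
  exact: List.in_map.
case: (derivable_unifier [:: prem]) => [|[s [xs sU]]]; first exact: d_botE.
have [h hK] := ord_name_inv (gs_n g).
(* [r] is the unifier written in the names of [D], and [back] returns from names to indices. *)
pose r i := tsubst (fun j => Var S (ord_name j)) (s i).
pose back y := Var S (h y).
have rK i : tsubst back (r i) = s i.
  rewrite /r tsubst_comp -[RHS]tsubst_Var; congr tsubst.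
  by apply/funext => j; rewrite /= /back hK.
pose D := Cond (finite_image (asubst r) (finite_In (eatom_atoms (gs_prem g)))).
(* The empty map is vacuously an injective variable map, so it is a morphism in all three
   categories. *)
have f : hom K D (empty_cond S).
  have e0 (x : cvars (empty_cond S)) : False by case: x.
  apply: (@Hom _ K D _ (fun x => False_rect _ (e0 x))) => [|_ [a []]].
  by case: (K) => //=; exists (fun x => False_rect _ (e0 x)) => x; case: (e0 x).
have D_prem : forces K T prem (C := D) r.
  suff H e : List.In e (gs_prem g) -> forces K T (eatom_formula e) (C := D) r.
    case=> i il /=; move: H il; rewrite /prem.
    elim: (gs_prem g) i => [|e l IH] [|i] //= H il; first by apply: H; left.
    by apply: IH => // e' le'; apply: H; right.
  case: e => [a|t u] ge; exists [set MorTo (hid K D)]; try exact: cov_hid.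
    move=> _ -> /=; rewrite asubst_Var; exists a => //.
    exact/In_eatom_atoms.
  (* [r] is [s] followed by naming, and [s] already makes both sides syntactically equal. *)
  move=> _ ->; congr tsubst; rewrite -!(tsubst_comp s); congr tsubst.
  exact: sU (prem_e _ ge).
have D_concl : @entails D _ concl r.
  apply: forces_sound_or; last first.
    apply: forces_mp D_prem.
    exact: (forces_all_block f r (@forces_stable_imp _ _ _) Hg).
  by move=> i; apply: forces_sound_ex_block; exact: forces_sound_fin_conj.
(* Since [x = s x] is derivable, it is enough to derive [concl] under [s]; the atoms in [L] follow
   from the premise in the same way. *)
rewrite -[concl]fsubst_Var; apply: (derivable_leibniz (s := s)).
  by move=> i; exact: derivable_eq_sym.
pose L := map (fun a => FAtom (asubst s a)) (eatom_atoms (gs_prem g)).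
apply: (derivable_cut (L := L)).
  move=> _ /List.in_map_iff [a [<- /In_eatom_atoms /prem_e]].
  rewrite -{1}[eatom_formula _]fsubst_Var.
  by apply: derivable_leibniz.
have := D_concl _ (L ++ [:: prem]) back.
rewrite (_ : (fun i => _) = s); last by apply/funext => i; exact: rK.
apply=> _ [a ga <-]; apply/List.in_or_app; left; apply/List.in_map_iff.
exists a; split=> //; rewrite asubst_comp; congr (FAtom (asubst _ a)).
by apply/funext => i; rewrite rK.
Qed.

End Main.

Theorem theorem5p11 (S : signature) (T : set (coherent_axiom S))
    (K : cat_kind) (phi : formula S 0) :
  geometric phi ->
  forces K T phi (C := empty_cond S) (no_var _) ->
  derivable (Tplus T) [::] phi.
Proof.
case=> [g|J g]; first exact: forces_geometric.
by move=> Hg; apply: d_andI => j; apply: forces_geometric (Hg j).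
Qed.
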